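(* Let $\Sigma$ be a brane obtained by gluing two $n$-dimensional $C^2$ oriented spacetimes with $C^3$ boundaries $(\mathcal{M}^\pm,g^\pm)$ so that the inherited first fundamental forms coincide ($=h$) and riggings satisfying the rigging conditions exist, and let $\tau_{\mu\nu}$ be the energy-momentum tensor on the brane, with tangential components $\tau_{ab}=e_a{}^\mu e_b{}^\nu\tau_{\mu\nu}$. For any choice of normalization (that is, of rigging, equivalently of the normal one-form), the condition $\tau_{ab}=-\Lambda h_{ab}$ on $\Sigma$ with a constant brane tension $\Lambda\neq 0$ is incompatible with a change of signature on $\Sigma$: if it holds, then the signature-changing set $S$ of $\Sigma$ is empty.
   Context: A $C^2$ spacetime with boundary is a $C^3$ manifold with $C^3$ boundary endowed with a $C^2$ Lorentzian metric (signature $(-,+,\dots,+)$). Gluing: there are an abstract $C^3$ manifold $\Sigma$ and $C^3$ embeddings $\Phi_\pm:\Sigma\to\mathcal{M}^\pm$ onto the boundaries $\Sigma^\pm$, with $\Phi_+^\star(g^+)=\Phi_-^\star(g^-)=h$; for local coordinates $\xi^a$ on $\Sigma$, $\vec e_a^{\,\pm}=d\Phi_\pm(\partial/\partial\xi^a)$. Rigging conditions: $\vec\ell_\pm$ are $C^2$ vector fields along $\Sigma^\pm$, nowhere tangent to $\Sigma^\pm$, with $\vec\ell_+$ pointing towards $\mathcal{M}^+$ and $\vec\ell_-$ pointing outwards from $\mathcal{M}^-$, and such that at corresponding points $g^+(\vec\ell_+,\vec\ell_+)=g^-(\vec\ell_-,\vec\ell_-)$ and $g^+(\vec\ell_+,\vec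 e_a^{\,+})=g^-(\vec\ell_-,\vec e_a^{\,-})$ for all $a$. Then the points of $\Sigma^\pm$ and the tangent spaces are identified ($\vec e_a=\vec e_a^{\,\pm}$, $\vec\ell=\vec\ell_\pm$), and $\mathcal{M}=\mathcal{M}^+\cup\mathcal{M}^-$ has a $C^3$ structure and a continuous metric $g$ equal to $g^\pm$ on $\mathcal{M}^\pm$. Normal: $\boldsymbol n$ is the one-form along $\Sigma$ with $n_\mu e_a{}^\mu=0$ and $n_\mu\ell^\mu=1$; $n^\mu=g^{\mu\nu}n_\nu$. Energy-momentum on the brane: put $\Pi^\alpha{}_\mu=\delta^\alpha_\mu-n_\mu\ell^\alpha$, $\mathcal{H}^\pm_{\mu\nu}=\Pi^\alpha{}_\mu\Pi^\beta{}_\nu\nabla^\pm_\alpha\ell_\beta|_\Sigma$ ($\nabla^\pm$ the Levi-Civita connection of $g^\pm$), $[\mathcal{H}_{\mu\nu}]=\mathcal{H}^+_{\mu\nu}-\mathcal{H}^-_{\mu\nu}$. The delta-supported part of the Einstein tensor distribution of $g$ has coefficient $$\mathcal{G}_{\mu\nu}=n^\alpha[\mathcal{H}_{\alpha\mu}]n_\nu+n^\alpha[\mathcal{H}_{\alpha\nu}]n_\mu-n^\alpha n_\alpha[\mathcal{H}_{\mu\nu}]-n_\mu n_\nu[\mathcal{H}^\alpha{}_\alpha]-g_{\mu\nu}\big(n^\alpha n^\beta[\mathcal{H}_{\alpha\beta}]-n^\alpha n_\alpha[\mathcal{H}^\beta{}_\beta]\big),$$ and, by the Einstein equations on the bulk,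 $\mathcal{G}_{\mu\nu}=\kappa_n^2\,\tau_{\mu\nu}$ with $\kappa_n>0$ a constant; this defines $\tau_{\mu\nu}$. Under a change of normalization $\vec\ell\to A^{-1}\vec\ell$ ($A$ nowhere zero), $\boldsymbol n\to A\boldsymbol n$ and $\mathcal{G}_{\mu\nu}$, $\tau_{\mu\nu}$ get multiplied by $A$. Causal character: with $(\boldsymbol n,\boldsymbol n)=g^{\mu\nu}n_\mu n_\nu$, let $\Sigma_E$, $\Sigma_0$, $\Sigma_L$ be the subsets of $\Sigma$ where $(\boldsymbol n,\boldsymbol n)<0$, $=0$, $>0$ respectively. The signature-changing set is $S=(\overline{\Sigma_L}\cap\Sigma_0)\cup(\overline{\Sigma_E}\cap\Sigma_0)$ (closures in $\Sigma$). *)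

(* Defs.v *)
From HB Require Import structures.
From mathcomp Require Import all_boot all_order all_algebra.
From mathcomp Require Import all_classical all_reals all_analysis.
Set Implicit Arguments.
Unset Strict Implicit.
Unset Printing Implicit Defensive.
Import Order.TTheory GRing.Theory Num.Theory.
Import numFieldNormedType.Exports.
Local Open Scope classical_set_scope.
Local Open Scope ring_scope.

(* Vectors and one-forms are row vectors of components in a chart; bilinear
   forms are matrices; an array of components at [p] is written
   [chart -> point -> components] and is meaningful only if [p] lies in the
   domain of the chart. *)

Section Calculus.
Context {R : realType} {d : nat}.
Implicit Types (D H : set 'rV[R]_d) (f : 'rV[R]_d -> R) (i : 'I_d).

Definition diff_quot f i (x : 'rV[R]_d) (t : R) : R :=
  t^-1 * (f (x + t *: delta_mx 0 i) - f x).

Definition steps D i (x : 'rV[R]_d) : set_system R :=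
  within [set t | D (x + t *: delta_mx 0 i)] (0 : R)^'.

(* Derivative along the [i]-th axis, relative to [D].  For [D] relatively open
   in a half-space it is the usual partial derivative, except for the direction
   transverse to the boundary at a boundary point, where it is one-sided. *)
Definition pderiv D f i (x : 'rV[R]_d) : R :=
  lim (diff_quot f i x t @[t --> steps D i x]).

(* [C^k] up to the boundary. *)
Fixpoint Ck (k : nat) D f : Prop :=
  {within D, continuous f} /\
  if k is k'.+1 then
    forall i, (forall x, D x -> cvg (diff_quot f i x t @[t --> steps D i x])) /\
              Ck k' D (pderiv D f i)
  else True.

Definition half_space {m : nat} : set 'rV[R]_m.+1 := [set x | 0 <= x 0 ord0].

End Calculus.

Section Manifolds.
Context {R : realType}.

Record chart (d : nat) (H : set 'rV[R]_d) (T : topologicalType) := Chart {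
  cdom : set T;
  cmap : T -> 'rV[R]_d;
  cinv : 'rV[R]_d -> T;
  cdom_open : open cdom;
  cmap_open : exists2 O, open O & cmap @` cdom = O `&` H;
  cmapK : forall p, cdom p -> cinv (cmap p) = p;
  cmap_continuous : {within cdom, continuous cmap};
  cinv_continuous : {within cmap @` cdom, continuous cinv} }.

(* [C^3] manifolds modelled on [H] (with boundary if [H] is the half-space,
   without boundary if [H] is the whole space). *)
Record manifold (d : nat) (H : set 'rV[R]_d) := Manifold {
  carrier :> topologicalType;
  carrier_hausdorff : hausdorff_space carrier;
  carrier_second_countable : @second_countable carrier;
  charts : Type;
  atlas : charts -> chart H carrier;
  chart_at : carrier -> charts;
  chart_atP : forall p, cdom (atlas (chart_at p)) p;
  atlas_C3 : forall c c' j,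
    Ck 3 (cmap (atlas c) @` (cdom (atlas c) `&` cdom (atlas c')))
      (fun x => cmap (atlas c') (cinv (atlas c) x) 0 j) }.

Definition chart_dom d (H : set 'rV[R]_d) (M : manifold H) (c : charts M) :
  set M := cdom (atlas c).
Definition chart_coord d (H : set 'rV[R]_d) (M : manifold H) (c : charts M) :
  M -> 'rV[R]_d := cmap (atlas c).
Definition chart_inv d (H : set 'rV[R]_d) (M : manifold H) (c : charts M) :
  'rV[R]_d -> M := cinv (atlas c).

(* [jacobian c c' p i j] is the derivative at [p] of the [j]-th coordinate of
   [c'] with respect to the [i]-th coordinate of [c]. *)
Definition jacobian d (H : set 'rV[R]_d) (M : manifold H) (c c' : charts M)
    (p : M) : 'M[R]_d :=
  \matrix_(i, j) pderiv (chart_coord c @` (chart_dom c `&` chart_dom c'))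
                   (fun x => chart_coord c' (chart_inv c x) 0 j) i
                   (chart_coord c p).

(* [o c p] says that the coordinate frame of [c] at [p] is negatively
   oriented; charts are not required to be orientation preserving. *)
Definition is_orientation d (H : set 'rV[R]_d) (M : manifold H)
    (o : charts M -> M -> bool) : Prop :=
  (forall c p, chart_dom c p -> \forall q \near p, o c q = o c p) /\
  (forall c c' p, chart_dom c p -> chart_dom c' p ->
     0 < (-1) ^+ (o c p (+) o c' p) * \det (jacobian c c' p)).

Definition lorentzian m (g : 'M[R]_m.+1) : Prop :=
  g^T = g /\
  exists2 P : 'M[R]_m.+1, P \in unitmx &
    P *m g *m P^T = diag_mx (\row_i (if i == ord0 then -1 else 1)).

Record spacetime (m : nat) := Spacetime {
  smfd :> manifold (@half_space R m);
  metric : charts smfd -> smfd -> 'M[R]_m.+1;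
  metric_tensor : forall c c' p, chart_dom c p -> chart_dom c' p ->
    metric c p = jacobian c c' p *m metric c' p *m (jacobian c c' p)^T;
  metric_lorentzian : forall c p, chart_dom c p -> lorentzian (metric c p);
  metric_C2 : forall c i j,
    Ck 2 (chart_coord c @` chart_dom c) (fun x => metric c (chart_inv c x) i j);
  orientation : charts smfd -> smfd -> bool;
  orientationP : is_orientation orientation }.

Definition boundary m (M : manifold (@half_space R m)) : set M :=
  [set p | chart_coord (chart_at p) p 0 ord0 = 0].

(* [dmetric c p k i j] is the derivative of the [(i, j)] component of the
   metric with respect to the [k]-th coordinate. *)
Definition dmetric m (M : spacetime m) (c : charts M) (p : M)
    (k i j : 'I_m.+1) : R :=
  pderiv (chart_coord c @` chart_dom c)
    (fun x => metric c (chart_inv c x) i j) k (chart_coord c p).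

Definition christoffel m (M : spacetime m) (c : charts M) (p : M)
    (k i j : 'I_m.+1) : R :=
  2^-1 * \sum_l invmx (metric c p) k l *
    (dmetric c p i l j + dmetric c p j l i - dmetric c p l i j).

End Manifolds.

Arguments manifold R {d} H.
Arguments spacetime R m : clear implicits.
Arguments boundary {R m} M.

Section Hypersurface.
Context {R : realType} {m : nat} {Sg : manifold R [set: 'rV[R]_m]}.
Context {M : spacetime R m}.
Variable Phi : Sg -> M.

(* The part of the chart [s] of [Sg] on which [Phi] is expressed in [c]. *)
Definition adapted (s : charts Sg) (c : charts M) : set 'rV[R]_m :=
  chart_coord s @` (chart_dom s `&` Phi @^-1` (chart_dom c)).

(* Row [a] is the vector [dPhi (d / d xi^a)]. *)
Definition tangent (s : charts Sg) (c : charts M) (q : Sg) : 'M[R]_(m, m.+1) :=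
  \matrix_(a, k) pderiv (adapted s c)
                   (fun x => chart_coord c (Phi (chart_inv s x)) 0 k) a
                   (chart_coord s q).

Definition C3_embedding : Prop :=
  [/\ injective Phi,
      continuous Phi,
      (forall U, open U -> exists2 V, open V & Phi @` U = V `&` range Phi),
      (forall s c k,
         Ck 3 (adapted s c)
           (fun x => chart_coord c (Phi (chart_inv s x)) 0 k)) &
      (forall s c q, chart_dom s q -> chart_dom c (Phi q) ->
         row_free (tangent s c q))].

Definition pullback_metric (s : charts Sg) (c : charts M) (q : Sg) : 'M[R]_m :=
  tangent s c q *m metric c (Phi q) *m (tangent s c q)^T.

Definition vector_along (l : charts M -> Sg -> 'rV[R]_m.+1) : Prop :=
  forall c c' q, chart_dom c (Phi q) -> chart_dom c' (Phi q) ->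
    l c' q = l c q *m jacobian c c' (Phi q).

Definition C2_vector_along (l : charts M -> Sg -> 'rV[R]_m.+1) : Prop :=
  vector_along l /\
  forall s c k, Ck 2 (adapted s c) (fun x => l c (chart_inv s x) 0 k).

Definition covector_along (w : charts M -> Sg -> 'rV[R]_m.+1) : Prop :=
  forall c c' q, chart_dom c (Phi q) -> chart_dom c' (Phi q) ->
    w c q = w c' q *m (jacobian c c' (Phi q))^T.

Definition nowhere_tangent (l : charts M -> Sg -> 'rV[R]_m.+1) : Prop :=
  forall s c q, chart_dom s q -> chart_dom c (Phi q) ->
    ~~ (l c q <= tangent s c q)%MS.

(* [l] is based at boundary points, where the [0]-th coordinate of every chart
   vanishes; it is positive in the interior. *)
Definition points_inwards (l : charts M -> Sg -> 'rV[R]_m.+1) : Prop :=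
  forall c q, chart_dom c (Phi q) -> 0 < l c q 0 ord0.

Definition points_outwards (l : charts M -> Sg -> 'rV[R]_m.+1) : Prop :=
  forall c q, chart_dom c (Phi q) -> l c q 0 ord0 < 0.

Definition normal_form (l w : charts M -> Sg -> 'rV[R]_m.+1) : Prop :=
  covector_along w /\
  forall s c q, chart_dom s q -> chart_dom c (Phi q) ->
    (forall a, \sum_k w c q 0 k * tangent s c q a k = 0) /\
    \sum_k w c q 0 k * l c q 0 k = 1.

(* The frame [(l, e_1, ..., e_m)] of the tangent space of [M] at [Phi q];
   label [0] is [l] and label [a + 1] is [e_a]. *)
Definition frame (l : charts M -> Sg -> 'rV[R]_m.+1) (s : charts Sg)
    (c : charts M) (q : Sg) : 'M[R]_(1 + m, m.+1) :=
  col_mx (l c q) (tangent s c q).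

Definition metric_in_frame l s c q : 'M[R]_(1 + m) :=
  frame l s c q *m metric c (Phi q) *m (frame l s c q)^T.

Definition covector_in_frame l s c q (w : charts M -> Sg -> 'rV[R]_m.+1) :
  'rV[R]_(1 + m) := w c q *m (frame l s c q)^T.

(* Row [a] is the covariant derivative along [e_a] of the vector field [l]. *)
Definition cov_deriv (l : charts M -> Sg -> 'rV[R]_m.+1) s c q :
    'M[R]_(m, m.+1) :=
  \matrix_(a, k)
    (pderiv (adapted s c) (fun x => l c (chart_inv s x) 0 k) a
       (chart_coord s q) +
     \sum_i \sum_j christoffel c (Phi q) k i j * tangent s c q a i * l c q 0 j).

(* Frame components of [nabla_alpha l_beta].  The row of the transverse
   derivative, which makes no sense for a field given only along the
   hypersurface, is set to [0]; it is annihilated by the projector [Pi]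
   in [calH]. *)
Definition cov_deriv_in_frame l s c q : 'M[R]_(1 + m) :=
  col_mx 0 (cov_deriv l s c q *m metric c (Phi q) *m (frame l s c q)^T).

(* [n] is given by its frame components; those of [l] are [(1, 0, ..., 0)]. *)
Definition calH l s c q (n : 'rV[R]_(1 + m)) : 'M[R]_(1 + m) :=
  let Pi : 'M[R]_(1 + m) := 1%:M - (delta_mx 0 ord0 : 'rV_(1 + m))^T *m n in
  Pi^T *m cov_deriv_in_frame l s c q *m Pi.

Definition norm_sq (n : charts M -> Sg -> 'rV[R]_m.+1) (q : Sg) : R :=
  let c := chart_at (Phi q) in
  \sum_i \sum_j invmx (metric c (Phi q)) i j * n c q 0 i * n c q 0 j.

Definition Sigma_E n : set Sg := [set q | norm_sq n q < 0].
Definition Sigma_0 n : set Sg := [set q | norm_sq n q = 0].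
Definition Sigma_L n : set Sg := [set q | 0 < norm_sq n q].

Definition signature_changing_set n : set Sg :=
  (closure (Sigma_L n) `&` Sigma_0 n) `|` (closure (Sigma_E n) `&` Sigma_0 n).

Definition renormalize (A : Sg -> R) (l : charts M -> Sg -> 'rV[R]_m.+1) :
    charts M -> Sg -> 'rV[R]_m.+1 :=
  fun c q => (A q)^-1 *: l c q.

End Hypersurface.

Definition C2_function (R : realType) (m : nat)
    (Sg : manifold R [set: 'rV[R]_m]) (A : Sg -> R) : Prop :=
  forall s, Ck 2 (chart_coord s @` chart_dom s) (fun x => A (chart_inv s x)).

Section Gluing.
Context {R : realType} {m : nat} {Sg : manifold R [set: 'rV[R]_m]}.
Context {Mp Mm : spacetime R m}.
Variables (Phip : Sg -> Mp) (Phim : Sg -> Mm).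

Definition same_first_fundamental_form : Prop :=
  forall s cp cm q,
    chart_dom s q -> chart_dom cp (Phip q) -> chart_dom cm (Phim q) ->
    pullback_metric Phip s cp q = pullback_metric Phim s cm q.

Definition glued : Prop :=
  [/\ C3_embedding Phip, range Phip = boundary Mp,
      C3_embedding Phim, range Phim = boundary Mm &
      same_first_fundamental_form].

Variables (lp : charts Mp -> Sg -> 'rV[R]_m.+1)
          (lm : charts Mm -> Sg -> 'rV[R]_m.+1).

Definition rigging_conditions : Prop :=
  [/\ C2_vector_along Phip lp /\ C2_vector_along Phim lm,
      nowhere_tangent Phip lp /\ nowhere_tangent Phim lm,
      points_inwards Phip lp,
      points_outwards Phim lm &
      forall s cp cm q,
        chart_dom s q -> chart_dom cp (Phip q) -> chart_dom cm (Phim q) ->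
        lp cp q *m metric cp (Phip q) *m (lp cp q)^T =
          lm cm q *m metric cm (Phim q) *m (lm cm q)^T /\
        lp cp q *m metric cp (Phip q) *m (tangent Phip s cp q)^T =
          lm cm q *m metric cm (Phim q) *m (tangent Phim s cm q)^T].

(* The tangent spaces of [Mp] and [Mm] at corresponding points are identified
   by matching the frames [(lp, e_a)] and [(lm, e_a)]; tensors on the
   identified space are given by their components in the common frame.  By the
   gluing and rigging conditions the frame components of the two metrics agree;
   the one-form [n] is represented on the side of [Mp]. *)

Definition jump_calH (n : charts Mp -> Sg -> 'rV[R]_m.+1) s cp cm q :
    'M[R]_(1 + m) :=
  let nf := covector_in_frame Phip lp s cp q n in
  calH Phip lp s cp q nf - calH Phim lm s cm q nf.

Definition calG (n : charts Mp -> Sg -> 'rV[R]_m.+1) s cp cm q :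
    'M[R]_(1 + m) :=
  let g := metric_in_frame Phip lp s cp q in
  let gi := invmx g in
  let nd i := covector_in_frame Phip lp s cp q n 0 i in
  let nu i := \sum_j gi i j * nd j in
  let J := jump_calH n s cp cm q in
  let nn := \sum_i nu i * nd i in
  let nJ i := \sum_j nu j * J j i in
  let nnJ := \sum_i \sum_j nu i * nu j * J i j in
  let trJ := \sum_i \sum_j gi i j * J j i in
  \matrix_(i, j) (nJ i * nd j + nJ j * nd i - nn * J i j - nd i * nd j * trJ
                  - g i j * (nnJ - nn * trJ)).

(* The Einstein equations read [calG = kappa ^+ 2 *: tau]. *)
Definition tau (kappa : R) n s cp cm q : 'M[R]_(1 + m) :=
  (kappa ^+ 2)^-1 *: calG n s cp cm q.

Definition tau_tangential (kappa : R) n s cp cm q : 'M[R]_m :=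
  \matrix_(a, b) tau kappa n s cp cm q (rshift 1 a) (rshift 1 b).

End Gluing.

(* Main.v *)
(* In the frame [(l, e_a)] the tangential part of the brane equation is
   [N J_ab = lam h_ab], where [N = (n, n)] and [J] is the jump of [calH].
   Where [N != 0], contracting it with [n n] and with [g^-1] forces
   [lam (1 - m) = kappa^2 Lambda].  For [m = 1] this is impossible, so that
   every point of the brane is null and [S] is empty.  For [m > 1] the factor
   [lam] is a nonzero constant, and letting [N] tend to [0] at a point of [S],
   near which [J] stays bounded, gives [h = 0] there; but [h] is the
   restriction of a nondegenerate form to a hyperplane of a space of dimension
   [m + 1 > 2].  For [m = 0] there are no null points. *)

Require Import Defs.
From HB Require Import structures.
From mathcomp Require Import all_boot all_order all_algebra.
From mathcomp Require Import all_classical all_reals all_analysis.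
From mathcomp Require Import ring.
Set Implicit Arguments.
Unset Strict Implicit.
Unset Printing Implicit Defensive.
Import Order.TTheory GRing.Theory Num.Theory.
Import numFieldNormedType.Exports.
Local Open Scope classical_set_scope.
Local Open Scope ring_scope.

(** * Entrywise continuity of matrix operations *)

Section ContinuousMatrices.
Context {R : realType} {T : topologicalType}.

Lemma continuous_det n (B : T -> 'M[R]_n) (q : T) :
  (forall i j, {for q, continuous (fun p => B p i j)}) ->
  {for q, continuous (fun p => \det (B p))}.
Proof.
move=> hB; rewrite /prop_for /continuous_at /determinant.
apply: (cvg_big (@add_continuous R)).
move=> s _; apply: cvgM; first exact: cvg_cst.
by apply: (cvg_big (@mul_continuous R)) => i _; exact: hB.
Qed.

Lemma continuous_mulmx k n p (B : T -> 'M[R]_(k, n)) (C : T -> 'M[R]_(n, p))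
    (q : T) :
  (forall i j, {for q, continuous (fun x => B x i j)}) ->
  (forall i j, {for q, continuous (fun x => C x i j)}) ->
  forall i j, {for q, continuous (fun x => (B x *m C x) i j)}.
Proof.
move=> hB hC i j.
have -> : (fun x => (B x *m C x) i j) = fun x => \sum_l B x i l * C x l j.
  by apply/funext => x; rewrite mxE.
apply: (cvg_big (@add_continuous R)) => l _.
by apply: cvgM; [exact: hB|exact: hC].
Qed.

Lemma continuous_trmx k n (B : T -> 'M[R]_(k, n)) (q : T) :
  (forall i j, {for q, continuous (fun x => B x i j)}) ->
  forall i j, {for q, continuous (fun x => (B x)^T i j)}.
Proof.
move=> hB i j.
have -> : (fun x => (B x)^T i j) = fun x => B x j i.
  by apply/funext => x; rewrite mxE.
exact: hB.
Qed.

Lemma continuous_col_mx k l n (B : T -> 'M[R]_(k, n)) (C : T -> 'M[R]_(l, n))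
    (q : T) :
  (forall i j, {for q, continuous (fun x => B x i j)}) ->
  (forall i j, {for q, continuous (fun x => C x i j)}) ->
  forall i j, {for q, continuous (fun x => col_mx (B x) (C x) i j)}.
Proof.
move=> hB hC i j; case: (split_ordP i) => i' ->.
  under [X in {for _, continuous X}]eq_fun do rewrite col_mxEu.
  exact: hB.
under [X in {for _, continuous X}]eq_fun do rewrite col_mxEd.
exact: hC.
Qed.

(** Cramer's formula for [invmx] holds only on invertible matrices (elsewhere [invmx] returns its
    argument), so it is used on the neighbourhood of [q] where the determinant stays nonzero. *)
Lemma continuous_invmx n (B : T -> 'M[R]_n) (q : T) :
  B q \in unitmx ->
  (forall i j, {for q, continuous (fun x => B x i j)}) ->
  forall i j, {for q, continuous (fun x => invmx (B x) i j)}.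
Proof.
move=> uB hB i j.
have dB := continuous_det hB.
have dB0 : \det (B q) != 0 by rewrite -unitfE -unitmxE.
have near_unit : \forall x \near q, invmx (B x) i j =
    (\det (B x))^-1 * cofactor (B x) j i.
  have : \forall x \near q, \det (B x) != 0.
    exact: cvgr_neq0 dB dB0.
  apply: filterS => x dx.
  by rewrite /invmx unitmxE unitfE dx !mxE.
apply: (@cvg_trans _ ((\det (B x))^-1 * cofactor (B x) j i @[x --> q])).
  by apply: near_eq_cvg; near=> x; apply/esym; near: x.
rewrite (nbhs_singleton near_unit).
apply: cvgM; first exact: cvgV.
apply: cvgM; first exact: cvg_cst.
apply: continuous_det => k l.
under [X in {for _, continuous X}]eq_fun do rewrite !mxE.
exact: hB.
Unshelve. all: by end_near.
Qed.

End ContinuousMatrices.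

(** * Linear algebra of the tangential brane equation *)

Section TangentialEquation.
Context {R : realFieldType} {m : nat}.

Lemma lshift1_ord0 (i : 'I_1) : lshift m i = ord0 :> 'I_(1 + m).
Proof. by rewrite (ord1 i); exact: val_inj. Qed.

Lemma rshift1_neq_ord0 (a : 'I_m) : (rshift 1 a == ord0) = false.
Proof. by []. Qed.

Lemma mul_delta_mx_ord0E (X : 'M[R]_(1 + m)) i j :
  ((delta_mx ord0 ord0 : 'M[R]_(1 + m)) *m X) i j = (i == ord0)%:R * X ord0 j.
Proof.
rewrite mxE (bigD1 ord0) //= big1 ?addr0; last first.
  by move=> k /negPf k0; rewrite mxE k0 andbF mul0r.
by rewrite mxE eqxx andbT.
Qed.

Lemma mulmx_delta_ord0E (X : 'M[R]_(1 + m)) i j :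
  (X *m (delta_mx ord0 ord0 : 'M[R]_(1 + m))) i j = X i ord0 * (j == ord0)%:R.
Proof.
rewrite mxE (bigD1 ord0) //= big1 ?addr0; last first.
  by move=> k /negPf k0; rewrite mxE k0 mulr0.
by rewrite mxE eqxx.
Qed.

(* With [K] the matrix [G] with its transverse row and column erased, the
   hypothesis is [N J = lam K]; contracting it with [nu nu] and with [G^-1]
   evaluates both contractions of [J] in terms of [lam]. *)
Lemma umbilical_jump_factor (G J : 'M[R]_(1 + m)) (c : R) :
  let gi := invmx G in
  let N := gi ord0 ord0 in
  let lam := c - (\sum_i \sum_j gi i ord0 * gi j ord0 * J i j)
               + N * \sum_i \sum_j gi i j * J j i in
  G \in unitmx -> G^T = G -> N != 0 ->
  (forall i, J i ord0 = 0) -> (forall j, J ord0 j = 0) ->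
  (forall a b : 'I_m, N * J (rshift 1 a) (rshift 1 b)
     = lam * G (rshift 1 a) (rshift 1 b)) ->
  lam * (1 - m%:R) = c.
Proof.
move=> gi N lam uG sG N0 J1 J2 hJ.
pose E : 'M[R]_(1 + m) := delta_mx ord0 ord0.
(* This is $(1-E)G(1-E)$ expanded, with $EGE = G_{00}E$. *)
pose K := G - E *m G - G *m E + G ord0 ord0 *: E.
have sgi : gi^T = gi by rewrite /gi trmx_inv sG.
have giG : gi *m G = 1%:M by rewrite mulVmx.
have Ggi : G *m gi = 1%:M by rewrite mulmxV.
have trE : \tr E = 1.
  rewrite /mxtrace (bigD1 ord0) //= big1 ?addr0 ?mxE ?eqxx //.
  by move=> k /negPf k0; rewrite mxE k0.
have EX (X : 'M[R]_(1 + m)) i j : (E *m X) i j = (i == ord0)%:R * X ord0 j.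
  exact: mul_delta_mx_ord0E.
have XE (X : 'M[R]_(1 + m)) i j : (X *m E) i j = X i ord0 * (j == ord0)%:R.
  exact: mulmx_delta_ord0E.
have KE i j : K i j = G i j - (E *m G) i j - (G *m E) i j
    + G ord0 ord0 * ((i == ord0) && (j == ord0))%:R.
  by rewrite !mxE.
(* The transverse row and column vanish on both sides; the tangential blocks agree by [hJ]. *)
have NJ : N *: J = lam *: K.
  apply/matrixP => i j.
  rewrite [LHS]mxE [RHS]mxE KE EX XE.
  case: (split_ordP i) => [i0|a] ->.
    rewrite lshift1_ord0 J2 eqxx.
    by case: (j == ord0) / eqP => [->|_] /=; ring.
  case: (split_ordP j) => [j0|b] ->.
    rewrite lshift1_ord0 J1 eqxx rshift1_neq_ord0 /=.
    by rewrite mul0r mulr1 subr0 subrr add0r !mulr0.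
  rewrite hJ !rshift1_neq_ord0 /=.
  by rewrite mul0r !mulr0 !subr0 addr0.
have giKgi : gi *m K *m gi
    = gi - gi *m E - E *m gi + G ord0 ord0 *: (gi *m E *m gi).
  rewrite /K !(mulmxDl, mulmxDr, mulmxN, mulNmx) -!scalemxAr -!scalemxAl.
  by rewrite !mulmxA giG !mul1mx -!mulmxA Ggi !mulmx1.
have nnK : (gi *m K *m gi) ord0 ord0 = - N + N ^+ 2 * G ord0 ord0.
  have -> : (gi *m K *m gi) ord0 ord0 = N - (gi *m E) ord0 ord0
      - (E *m gi) ord0 ord0 + G ord0 ord0 * (gi *m E *m gi) ord0 ord0.
    by rewrite giKgi !mxE.
  have -> : (gi *m E *m gi) ord0 ord0 = N * N.
    rewrite mxE (bigD1 ord0) //= big1 ?addr0 ?XE ?eqxx ?mulr1 //.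
    by move=> k /negPf k0; rewrite XE k0 mulr0 mul0r.
  by rewrite XE EX eqxx mulr1 mul1r -/N; ring.
(* The identity has trace $1+m$, and each of the two terms linear in [E] removes 1. *)
have trK : \tr (gi *m K) = m%:R - 1 + N * G ord0 ord0.
  rewrite /K !(mulmxDr, mulmxN) -!scalemxAr !(mxtraceD, raddfN, mxtraceZ) /=.
  rewrite !mulmxA giG mul1mx mxtrace1 -[_ *m E *m G]mulmxA mxtrace_mulC.
  rewrite -mulmxA Ggi mulmx1 trE.
  have -> : \tr (gi *m E) = N.
    rewrite /mxtrace (bigD1 ord0) //= big1 ?addr0 ?XE ?eqxx ?mulr1 //.
    by move=> k /negPf k0; rewrite XE k0 mulr0.
  by rewrite natrD; ring.
have nnJE : \sum_i \sum_j gi i ord0 * gi j ord0 * J i j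
    = (gi *m J *m gi) ord0 ord0.
  have gi0 i : gi ord0 i = gi i ord0 by rewrite -[in LHS]sgi mxE.
  rewrite -mulmxA mxE; apply: eq_bigr => i _.
  rewrite mxE mulr_sumr; apply: eq_bigr => j _.
  by rewrite gi0 mulrA -!mulrA [J i j * _]mulrC.
have trJE : \sum_i \sum_j gi i j * J j i = \tr (gi *m J).
  by apply: eq_bigr => i _; rewrite mxE.
have nnJ : N * (gi *m J *m gi) ord0 ord0 = lam * (- N + N ^+ 2 * G ord0 ord0).
  transitivity ((gi *m (N *: J) *m gi) ord0 ord0).
    by rewrite -scalemxAr -scalemxAl [RHS]mxE.
  by rewrite NJ -scalemxAr -scalemxAl mxE nnK.
have trJ : N * \tr (gi *m J) = lam * (m%:R - 1 + N * G ord0 ord0).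
  by rewrite -mxtraceZ scalemxAr NJ -scalemxAr mxtraceZ trK.
(* Both contractions of [J] are inserted into the definition of [lam]; the terms in $G_{00}$ then
   cancel and leave $\lambda = c + m\lambda$. *)
have : lam = c - lam * (- 1 + N * G ord0 ord0)
              + lam * (m%:R - 1 + N * G ord0 ord0).
  rewrite {1}/lam nnJE trJE trJ; congr (_ - _ + _).
  by apply: (mulfI N0); rewrite nnJ; ring.
move/eqP; rewrite -subr_eq0 => /eqP h; apply/eqP; rewrite -subr_eq0.
by rewrite -h; apply/eqP; ring.
Qed.

(* Otherwise a nontrivial combination of two tangential rows of [G] vanishes. *)
Lemma unitmx_hyperplane_neq0 (G : 'M[R]_(1 + m)) : (1 < m)%N ->
  G \in unitmx -> exists a b : 'I_m, G (rshift 1 a) (rshift 1 b) != 0.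
Proof.
move=> m1 uG; apply: contrapT => hG.
have G0 a b : G (rshift 1 a) (rshift 1 b) = 0.
  by apply/eqP; apply: contrapT => /negP h; apply: hG; exists a, b.
pose a := rshift 1 (Ordinal (ltnW m1)); pose b := rshift 1 (Ordinal m1).
have Grow (x y : R)
    (v := x *: delta_mx ord0 a + y *: delta_mx ord0 b : 'rV[R]_(1 + m)) :
    x * G a ord0 + y * G b ord0 = 0 -> v = 0.
  move=> xy; rewrite -[v](mulmxK uG) (_ : v *m G = 0) ?mul0mx //.
  apply/rowP => j; rewrite mulmxDl -!scalemxAl -!rowE !mxE.
  case: (split_ordP j) => [j0|c] ->; last by rewrite !G0; ring.
  by rewrite lshift1_ord0.
(* The weights $G_{b0}$ and $-G_{a0}$ cancel in column 0, the only one where these rows can be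
   nonzero. The coefficient of [b] gives $G_{a0}=0$, so row [a] itself is zero. *)
have Ga0 : G a ord0 = 0.
  have /rowP/(_ b) := Grow (G b ord0) (- G a ord0) ltac:(ring).
  rewrite !mxE !eqxx /= mulr1 mulr0 add0r.
  by move/eqP; rewrite oppr_eq0 => /eqP.
have /rowP/(_ a) := Grow 1 0 ltac:(by rewrite Ga0; ring).
by rewrite !mxE !eqxx mul0r mulr1 addr0; apply/eqP; rewrite oner_eq0.
Qed.

End TangentialEquation.

(** * Calculus on chart images *)

Section Calculus.
Context {R : realType} {d : nat}.
Implicit Types (D : set 'rV[R]_d) (f a : 'rV[R]_d -> R) (x : 'rV[R]_d).

Lemma Ck_continuous k D f : Ck k D f -> {within D, continuous f}.
Proof. by case: k => [|k] []. Qed.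

Lemma Ck_pderiv k D f i : Ck k.+1 D f -> Ck k D (pderiv D f i).
Proof. by case=> _ /(_ i) []. Qed.

Lemma CkS k D f : Ck k.+1 D f -> Ck k D f.
Proof.
elim: k f => [|k IHk] f [cf df]; split => // i.
by have [cv /IHk dfi] := df i; split.
Qed.

(** Transfers continuity from a chart image to the manifold. It suffices that [u] stays in [D] near
    [q]; [D] may fail to be a neighbourhood of [u q], as for a spacetime chart at a boundary
    point. *)
Lemma continuous_within_comp (T : topologicalType) D f (u : T -> 'rV[R]_d)
    (q : T) :
  {within D, continuous f} -> {for q, continuous u} ->
  (\forall p \near q, D (u p)) -> {for q, continuous (fun p => f (u p))}.
Proof.
move=> /subspace_continuousP cf cu nD.
have Du := nbhs_singleton nD.
apply: (@cvg_comp _ _ _ u f _ (within D (nbhs (u q)))); last exact: cf.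
move=> V /cu nV; have nV' : \forall p \near q, D (u p) -> V (u p) by [].
by apply: filterS2 nD nV' => p Dp; apply.
Qed.

Lemma cvg_axis i x : (x + t *: delta_mx 0 i) @[t --> (0 : R)] --> x.
Proof.
suff : (x + t *: delta_mx 0 i) @[t --> (0 : R)] --> x + 0 *: delta_mx 0 i.
  by rewrite scale0r addr0.
by apply: cvgD; [exact: cvg_cst|apply: cvgZr_tmp; exact: cvg_id].
Qed.

(** All small steps from an interior point stay in [D], so difference quotients there are
    two-sided. *)
Lemma steps_nbhs D i x : nbhs x D -> steps D i x = (0 : R)^'.
Proof.
move=> nD; have nst : \forall t \near (0 : R)^', D (x + t *: delta_mx 0 i).
  by apply: nbhs_dnbhs; exact: cvg_axis nD.
rewrite /steps; apply/funext => P; apply/propext; split => hP.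
  have hP' : \forall t \near (0 : R)^', D (x + t *: delta_mx 0 i) -> P t by [].
  by apply: filterS2 nst hP' => t Dt; apply.
by apply: filterS hP => t Pt _.
Qed.

Lemma cvg_axis_step D f i x : open D -> D x -> {within D, continuous f} ->
  f (x + t *: delta_mx 0 i) @[t --> (0 : R)^'] --> f x.
Proof.
move=> oD Dx; rewrite continuous_open_subspace // => cf.
have cx : {for x, continuous f} by apply: cf; rewrite inE.
apply: cvg_within_filter.
by have := cvg_comp (fun t => x + t *: delta_mx 0 i) f (@cvg_axis i x) cx.
Qed.

(* Both derivatives are two-sided because the domains are open. *)
Lemma pderiv_invM D D' (a f : 'rV[R]_d -> R) i x : open D -> open D' ->
  D x -> D' x -> Ck 1 D' a -> Ck 1 D f -> (forall y, a y != 0) ->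
  pderiv D (fun y => (a y)^-1 * f y) i x =
    (a x)^-1 * pderiv D f i x - (a x)^-1 * (a x)^-1 * f x * pderiv D' a i x.
Proof.
move=> oD oD' Dx D'x [ca da] [cf df] a0.
have sD : steps D i x = (0 : R)^'.
  by apply: steps_nbhs; exact: open_nbhs_nbhs.
have sD' : steps D' i x = (0 : R)^'.
  by apply: steps_nbhs; exact: open_nbhs_nbhs.
have /(_ _ Dx) := (df i).1; have /(_ _ D'x) := (da i).1.
rewrite /pderiv sD sD' => cda cdf.
apply: cvg_lim => //.
(* An exact quotient rule for finite increments; the shifted values of [a] and [f] tend to those at
   [x] by continuity. *)
have -> : diff_quot (fun y => (a y)^-1 * f y) i x =
    fun t => (a x)^-1 * diff_quot f i x t -
      (a x)^-1 * (a (x + t *: delta_mx 0 i))^-1 * f (x + t *: delta_mx 0 i) *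
        diff_quot a i x t.
  apply/funext => t; rewrite /diff_quot.
  move: (a0 x) (a0 (x + t *: delta_mx 0 i)); move: (t^-1) => u ? ?.
  by field; apply/andP.
apply: cvgB; first by apply: cvgM => //; exact: cvg_cst.
apply: cvgM => //; apply: cvgM; last exact: (cvg_axis_step _ oD).
apply: cvgM; first exact: cvg_cst.
by apply: cvgV => //; exact: (cvg_axis_step _ oD').
Qed.

End Calculus.

(** * Local transfer of continuity and topology of charts *)

Lemma near_eq_continuous (T U : topologicalType) (f g : T -> U) (q : T) :
  (\forall p \near q, f p = g p) ->
  {for q, continuous f} -> {for q, continuous g}.
Proof.
move=> fg cf; rewrite /prop_for /continuous_at -(nbhs_singleton fg).
exact: cvg_trans (near_eq_cvg fg) cf.
Qed.

Section Charts.
Context {R : realType} {d : nat} {H : set 'rV[R]_d} {M : manifold R H}.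
Implicit Types (c : charts M) (p : M).

Lemma chart_dom_near c p : chart_dom c p -> \forall q \near p, chart_dom c q.
Proof.
by move=> dp; apply: open_nbhs_nbhs; split => //; exact: cdom_open.
Qed.

Lemma chart_coord_continuous c p :
  chart_dom c p -> {for p, continuous (chart_coord c)}.
Proof.
move=> dp; have := cmap_continuous (c := atlas c).
rewrite continuous_open_subspace; last exact: cdom_open.
by apply; rewrite inE.
Qed.

End Charts.

(** As [Sg] is modelled on the whole space, its chart images are open there, and the inverse chart
    is continuous on them. Hence partial derivatives along [Sg] are two-sided. *)
Lemma open_chart_image (R : realType) (m : nat)
    (Sg : manifold R [set: 'rV[R]_m]) (s : charts Sg) (U : set Sg) :
  open U -> U `<=` chart_dom s -> open (chart_coord s @` U).
Proof.
move=> oU Us; have [W oW DW] := cmap_open (atlas s).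
rewrite setIT in DW; have oD := oW; rewrite -DW in oD.
have := cinv_continuous (c := atlas s); rewrite continuous_open_subspace //.
move=> ci; rewrite openE => _ [p Up <-].
have Dp : cdom (atlas s) p by exact: Us.
have /ci cip : cmap (atlas s) p \in cmap (atlas s) @` cdom (atlas s).
  by rewrite inE; exists p.
have nU : \forall x \near cmap (atlas s) p, U (cinv (atlas s) x).
  by apply: cip; rewrite cmapK //; apply: open_nbhs_nbhs; split.
have nD : \forall x \near cmap (atlas s) p,
    (cmap (atlas s) @` cdom (atlas s)) x.
  by apply: open_nbhs_nbhs; split => //; exists p.
apply: filterS2 nU nD => x Ux [p' Dp' xE].
by exists p' => //; rewrite -(cmapK Dp') xE.
Qed.

(** * Continuity of the geometric data along the hypersurface *)

Section AlongHypersurface.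
Context {R : realType} {m : nat} {Sg : manifold R [set: 'rV[R]_m]}.
Context {M : spacetime R m}.
Variable Phi : Sg -> M.
Hypothesis hPhi : C3_embedding Phi.
Variables (s : charts Sg) (c : charts M).
Implicit Types (q : Sg) (l : charts M -> Sg -> 'rV[R]_m.+1).

Let cPhi : continuous Phi. Proof. by case: hPhi. Qed.

Lemma near_chart_dom_comp q :
  chart_dom c (Phi q) -> \forall p \near q, chart_dom c (Phi p).
Proof. by move=> /chart_dom_near; exact: cPhi. Qed.

Lemma adapted_coord q : chart_dom s q -> chart_dom c (Phi q) ->
  adapted Phi s c (chart_coord s q).
Proof. by move=> sq cq; exists q. Qed.

Lemma adapted_open : open (adapted Phi s c).
Proof.
apply: open_chart_image; last by move=> p [].
apply: openI; first exact: cdom_open.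
by apply: open_comp; [move=> p _; exact: cPhi|exact: cdom_open].
Qed.

Lemma continuous_adapted k f q : Ck k (adapted Phi s c) f ->
  chart_dom s q -> chart_dom c (Phi q) ->
  {for q, continuous (fun p => f (chart_coord s p))}.
Proof.
move=> /Ck_continuous cf sq cq.
apply: (continuous_within_comp cf); first exact: chart_coord_continuous.
apply: filterS2 (chart_dom_near sq) (near_chart_dom_comp cq) => p.
exact: adapted_coord.
Qed.

(** Regularity up to the boundary is enough even if [Phi q] is a boundary point, since the
    coordinates of [Phi p] stay in the chart image. *)
Lemma continuous_ambient k f q : Ck k (chart_coord c @` chart_dom c) f ->
  chart_dom c (Phi q) ->
  {for q, continuous (fun p => f (chart_coord c (Phi p)))}.
Proof.
move=> /Ck_continuous cf cq; apply: (continuous_within_comp cf).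
  apply: (@continuous_comp _ _ _ Phi (chart_coord c)); first exact: cPhi.
  exact: chart_coord_continuous.
by apply: filterS (near_chart_dom_comp cq) => p cp; exists (Phi p).
Qed.

Lemma continuous_tangent q a k : chart_dom s q -> chart_dom c (Phi q) ->
  {for q, continuous (fun p => tangent Phi s c p a k)}.
Proof.
move=> sq cq; under [X in {for _, continuous X}]eq_fun do rewrite mxE.
have [_ _ _ /(_ s c k) hk _] := hPhi.
exact: continuous_adapted (Ck_pderiv a hk) sq cq.
Qed.

Lemma continuous_metric q i j : chart_dom c (Phi q) ->
  {for q, continuous (fun p => metric c (Phi p) i j)}.
Proof.
move=> cq; apply: near_eq_continuous
  (continuous_ambient (metric_C2 c i j) cq).
apply: filterS (near_chart_dom_comp cq) => p cp.
by rewrite /chart_inv /chart_coord cmapK.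
Qed.

(** A matrix congruent to a diagonal one with entries $\pm 1$ has nonzero determinant. *)
Lemma metric_unit p : chart_dom c p -> metric c p \in unitmx.
Proof.
move=> /metric_lorentzian [_ [P uP /(congr1 determinant)]].
rewrite !det_mulmx det_diag => /eqP hdet; rewrite unitmxE unitfE.
apply/eqP => g0; move: hdet; rewrite g0 mulr0 mul0r eq_sym; apply/negP.
rewrite prodf_seq_neq0; apply/allP => i _ /=; rewrite mxE.
by case: ifP => _; rewrite ?oppr_eq0 oner_eq0.
Qed.

Lemma continuous_christoffel q k i j : chart_dom c (Phi q) ->
  {for q, continuous (fun p => christoffel c (Phi p) k i j)}.
Proof.
move=> cq.
have cd k' i' j' : {for q, continuous (fun p => dmetric c (Phi p) k' i' j')}.
  exact: continuous_ambient (Ck_pderiv k' (metric_C2 c i' j')) cq.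
apply: cvgM; first exact: cvg_cst.
apply: (cvg_big (@add_continuous R)) => u _; apply: cvgM.
  apply: (continuous_invmx (B := fun p => metric c (Phi p))).
    exact: metric_unit.
  by move=> ? ?; exact: continuous_metric.
by apply: cvgB; [apply: cvgD|]; exact: cd.
Qed.

Variables (A : Sg -> R) (l : charts M -> Sg -> 'rV[R]_m.+1).
Hypotheses (hA : C2_function A) (A0 : forall q, A q != 0).
Hypothesis hl : C2_vector_along Phi l.

Lemma continuous_C2_function q : chart_dom s q -> {for q, continuous A}.
Proof.
move=> sq; apply: (@near_eq_continuous _ _
  (fun p => A (chart_inv s (chart_coord s p)))).
  apply: filterS (chart_dom_near sq) => p sp.
  by rewrite /chart_inv /chart_coord cmapK.
apply: (continuous_within_comp (Ck_continuous (hA s))).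
  exact: chart_coord_continuous.
by apply: filterS (chart_dom_near sq) => p sp; exists p.
Qed.

Lemma continuous_vector_along q k : chart_dom s q -> chart_dom c (Phi q) ->
  {for q, continuous (fun p => l c p 0 k)}.
Proof.
move=> sq cq; apply: near_eq_continuous
  (continuous_adapted (hl.2 s c k) sq cq).
apply: filterS (chart_dom_near sq) => p sp.
by rewrite /chart_inv /chart_coord cmapK.
Qed.

Lemma continuous_renormalize q i k : chart_dom s q -> chart_dom c (Phi q) ->
  {for q, continuous (fun p => renormalize A l c p i k)}.
Proof.
move=> sq cq; rewrite (ord1 i).
under [X in {for _, continuous X}]eq_fun do rewrite mxE.
apply: cvgM; last exact: continuous_vector_along.
by apply: cvgV => //; exact: continuous_C2_function.
Qed.

Lemma continuous_metric_in_frame q i j : chart_dom s q -> chart_dom c (Phi q) ->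
  {for q, continuous
    (fun p => metric_in_frame Phi (renormalize A l) s c p i j)}.
Proof.
move=> sq cq.
have cF i' j' : {for q, continuous
    (fun p => frame Phi (renormalize A l) s c p i' j')}.
  apply: continuous_col_mx => ? ?; first exact: continuous_renormalize.
  exact: continuous_tangent.
apply: continuous_mulmx => [i' j'|]; last exact: continuous_trmx.
by apply: continuous_mulmx => // ? ?; exact: continuous_metric.
Qed.

(** Regularity is given for [A] and [l] separately, on different domains. Near [q] the quotient rule
    expresses the derivative of [renormalize A l] through their continuous derivatives. *)
Lemma continuous_cov_deriv q a k : chart_dom s q -> chart_dom c (Phi q) ->
  {for q, continuous (fun p => cov_deriv Phi (renormalize A l) s c p a k)}.
Proof.
move=> sq cq; under [X in {for _, continuous X}]eq_fun do rewrite mxE.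
apply: cvgD; last first.
  apply: (cvg_big (@add_continuous R)) => i _.
  apply: (cvg_big (@add_continuous R)) => j _.
  apply: cvgM; last exact: continuous_renormalize.
  by apply: cvgM; [exact: continuous_christoffel|exact: continuous_tangent].
have CA1 : Ck 1 (chart_coord s @` chart_dom s) (fun x => A (chart_inv s x)).
  exact: CkS (hA s).
have Cl1 : Ck 1 (adapted Phi s c) (fun x => l c (chart_inv s x) 0 k).
  exact: CkS (hl.2 s c k).
pose V p := (A p)^-1 * pderiv (adapted Phi s c)
    (fun x => l c (chart_inv s x) 0 k) a (chart_coord s p) -
  (A p)^-1 * (A p)^-1 * l c p 0 k *
    pderiv (chart_coord s @` chart_dom s) (fun x => A (chart_inv s x)) a
      (chart_coord s p).
apply: (@near_eq_continuous _ _ V).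
  apply: filterS2 (chart_dom_near sq) (near_chart_dom_comp cq) => p sp cp.
  have -> : (fun x => renormalize A l c (chart_inv s x) 0 k) =
      fun x => (A (chart_inv s x))^-1 * l c (chart_inv s x) 0 k.
    by apply/funext => x; rewrite mxE.
  rewrite (pderiv_invM (D' := chart_coord s @` chart_dom s)) //.
  - by rewrite /V /chart_inv /chart_coord cmapK.
  - exact: adapted_open.
  - by apply: open_chart_image => //; exact: cdom_open.
  - exact: adapted_coord.
have cA : (A p)^-1 @[p --> q] --> (A q)^-1.
  by apply: cvgV => //; exact: continuous_C2_function.
apply: cvgB.
  apply: cvgM => //; exact: continuous_adapted (Ck_pderiv a (hl.2 s c k)) sq cq.
apply: cvgM.
  by apply: cvgM; [exact: cvgM|exact: continuous_vector_along].
apply: (continuous_within_comp (Ck_continuous (Ck_pderiv a (hA s)))).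
  exact: chart_coord_continuous.
by apply: filterS (chart_dom_near sq) => p sp; exists p.
Qed.

(** This matrix is the tangential block of [calH]; its continuity on each side controls the jump as
    $(n,n)$ tends to 0. *)
Lemma continuous_tangential_cov_deriv q a b :
  chart_dom s q -> chart_dom c (Phi q) ->
  {for q, continuous (fun p => (cov_deriv Phi (renormalize A l) s c p *m
     metric c (Phi p) *m (tangent Phi s c p)^T) a b)}.
Proof.
move=> sq cq; apply: continuous_mulmx => [i j|].
  apply: continuous_mulmx => ? ?; first exact: continuous_cov_deriv.
  exact: continuous_metric.
by apply: continuous_trmx => ? ?; exact: continuous_tangent.
Qed.

End AlongHypersurface.

(** * Components in the frame of the rigging and the tangent vectors *)

Section Frame.
Context {R : realType} {m : nat} {Sg : manifold R [set: 'rV[R]_m]}.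
Context {M : spacetime R m}.
Variable Phi : Sg -> M.
Implicit Types (s : charts Sg) (c : charts M) (q : Sg).
Implicit Types (l n : charts M -> Sg -> 'rV[R]_m.+1).

(** The normal is the same constant covector at every point of the frame, so contractions with it
    reduce to picking entries of index [ord0]. *)
Lemma covector_in_frame_normal l n s c q : normal_form Phi l n ->
  chart_dom s q -> chart_dom c (Phi q) ->
  covector_in_frame Phi l s c q n = delta_mx 0 ord0.
Proof.
move=> [_ hn] sq cq; have [ne nl] := hn s c q sq cq.
apply/rowP => i; rewrite /covector_in_frame /frame mxE.
case: (split_ordP i) => [i0|a] ->.
  transitivity (1 : R); last by rewrite mxE lshift1_ord0.
  rewrite (ord1 i0); under eq_bigr => k _ do rewrite mxE col_mxEu.
  exact: nl.
rewrite [RHS]mxE rshift1_neq_ord0 /=.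
under eq_bigr => k _ do rewrite mxE col_mxEd.
exact: ne.
Qed.

(** Pairing a vanishing combination of frame vectors with [n] isolates the coefficient of the
    rigging, which is thus 0; the others vanish because the tangent vectors are independent. *)
Lemma frame_unit l n s c q : C3_embedding Phi -> normal_form Phi l n ->
  chart_dom s q -> chart_dom c (Phi q) ->
  (frame Phi l s c q : 'M[R]_(1 + m)) \in unitmx.
Proof.
move=> [_ _ _ _ hfree] hn sq cq.
rewrite -row_free_unit; apply: inj_row_free => v vF.
have v0 : v 0 ord0 = 0.
  have := congr1 (fun u => u *m (n c q)^T) vF.
  rewrite mul0mx -mulmxA.
  have -> : frame Phi l s c q *m (n c q)^T = (delta_mx 0 ord0)^T.
    rewrite -(covector_in_frame_normal hn sq cq) /covector_in_frame.
    by rewrite trmx_mul trmxK.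
  rewrite trmx_delta => /matrixP/(_ 0 0); rewrite mxE (bigD1 ord0) //= big1.
    by rewrite !mxE eqxx mulr1 addr0.
  by move=> k /negPf k0; rewrite mxE k0 mulr0.
have rv : rsubmx v = 0.
  apply: (row_free_inj (hfree s c q sq cq)); rewrite mul0mx -[RHS]vF.
  rewrite -{2}[v]hsubmxK mul_row_col (_ : lsubmx v = 0) ?mul0mx ?add0r //.
  by apply/rowP => i; rewrite !mxE lshift1_ord0 v0.
apply/rowP => i; case: (split_ordP i) => [i0|a] ->.
  by rewrite lshift1_ord0 v0 mxE.
by have /rowP/(_ a) := rv; rewrite !mxE.
Qed.

Lemma metric_in_frame_unit l n s c q : C3_embedding Phi ->
  normal_form Phi l n -> chart_dom s q -> chart_dom c (Phi q) ->
  metric_in_frame Phi l s c q \in unitmx.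
Proof.
move=> hPhi hn sq cq; have uF := frame_unit hPhi hn sq cq.
rewrite /metric_in_frame !unitmx_mul unitmx_tr uF.
by rewrite (_ : metric c (Phi q) \in unitmx) //; exact: metric_unit.
Qed.

Lemma tr_metric c q : chart_dom c (Phi q) ->
  (metric c (Phi q))^T = metric c (Phi q).
Proof. by case/metric_lorentzian. Qed.

Lemma tr_metric_in_frame l s c q : chart_dom c (Phi q) ->
  (metric_in_frame Phi l s c q)^T = metric_in_frame Phi l s c q.
Proof.
by move=> cq; rewrite /metric_in_frame !trmx_mul trmxK tr_metric // mulmxA.
Qed.

Lemma metric_in_frameE l s c q :
  metric_in_frame Phi l s c q =
  block_mx (l c q *m metric c (Phi q) *m (l c q)^T)
           (l c q *m metric c (Phi q) *m (tangent Phi s c q)^T)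
           (tangent Phi s c q *m metric c (Phi q) *m (l c q)^T)
           (pullback_metric Phi s c q).
Proof.
by rewrite /metric_in_frame /frame tr_col_mx mul_col_mx mul_col_row.
Qed.

(** With $F$ the frame matrix and $e$ the first basis covector, $n = eF^{-T}$ and $(FgF^T)^{-1} =
    F^{-T}g^{-1}F^{-1}$, so $(n,n)$ is the corner entry of the latter. *)
Lemma norm_sqE l n s q : C3_embedding Phi -> normal_form Phi l n ->
  chart_dom s q -> norm_sq Phi n q =
  invmx (metric_in_frame Phi l s (chart_at (Phi q)) q) ord0 ord0.
Proof.
move=> hPhi hn sq; rewrite /norm_sq; set c := chart_at _.
have cq : chart_dom c (Phi q) by exact: chart_atP.
have uF := frame_unit hPhi hn sq cq.
have uG := metric_in_frame_unit hPhi hn sq cq.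
have ug : metric c (Phi q) \in unitmx by exact: metric_unit.
have nF := covector_in_frame_normal hn sq cq.
set F : 'M[R]_(1 + m) := frame Phi l s c q in uF.
set g : 'M[R]_(1 + m) := metric c (Phi q) in ug.
pose X := invmx F^T *m invmx g *m invmx F.
have -> : invmx (metric_in_frame Phi l s c q) = X.
  rewrite -[X]mul1mx -(mulVmx uG) -[RHS]mulmxA.
  rewrite (_ : metric_in_frame Phi l s c q *m X = 1%:M) ?mulmx1 //.
  rewrite /X /metric_in_frame -/F -/g !mulmxA.
  by rewrite mulmxK ?unitmx_tr // mulmxK // mulmxV.
pose e : 'rV[R]_(1 + m) := delta_mx 0 ord0.
have nE : n c q = e *m invmx F^T.
  by rewrite /e -nF /covector_in_frame -/F mulmxK // unitmx_tr.
transitivity ((n c q *m invmx g *m (n c q)^T) 0 0).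
  rewrite exchange_big mxE; apply: eq_bigr => j _ /=.
  rewrite mxE mulr_suml; apply: eq_bigr => i _.
  by rewrite mxE [n c q 0 i * _]mulrC.
rewrite nE trmx_mul trmx_inv trmxK -!mulmxA.
have -> : invmx F^T *m (invmx g *m (invmx F *m e^T)) =
  X *m e^T by rewrite !mulmxA.
by rewrite /e trmx_delta mulmxA -rowE -colE !mxE.
Qed.

(** For this normal, $\Pi$ is the identity with its [ord0] diagonal entry erased, so only the
    tangential block survives. *)
Lemma calH_normalE l s c q :
  calH Phi l s c q (delta_mx 0 ord0) =
  block_mx 0 0 0 (cov_deriv Phi l s c q *m metric c (Phi q) *m
                  (tangent Phi s c q)^T).
Proof.
have PiE : 1%:M - (delta_mx 0 ord0 : 'rV[R]_(1 + m))^T *m delta_mx 0 ord0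
    = block_mx 0 0 0 1%:M :> 'M[R]_(1 + m).
  rewrite trmx_delta mul_delta_mx; apply/matrixP => i j.
  rewrite mxE [in LHS]mxE.
  case: (split_ordP i) => [i0|a] ->; case: (split_ordP j) => [j0|b] ->.
  - by rewrite block_mxEul (ord1 i0) (ord1 j0) !mxE eqxx subrr.
  - by rewrite block_mxEur !mxE !andbF eq_lrshift subr0.
  - by rewrite block_mxEdl !mxE eq_rlshift subr0.
  - by rewrite block_mxEdr !mxE eq_rshift subr0.
rewrite /calH PiE /cov_deriv_in_frame /frame tr_col_mx mul_mx_row.
rewrite tr_block_mx !trmx0 trmx1.
rewrite -(row_mx0 _ 1 1 m) -block_mxEv !mulmx_block.
by rewrite !(mul0mx, mulmx0, mul1mx, mulmx1, add0r, addr0).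
Qed.

End Frame.

(** * Matching the two sides; tangential part of the Einstein tensor *)

Section Gluing.
Context {R : realType} {m : nat} {Sg : manifold R [set: 'rV[R]_m]}.
Context {Mp Mm : spacetime R m}.
Variables (Phip : Sg -> Mp) (Phim : Sg -> Mm).
Implicit Types (n l : charts Mp -> Sg -> 'rV[R]_m.+1).

(* The matching conditions equate both sides with the same data on [Mm], which
   spares a chain rule for the coordinates of [Mp]. *)
Lemma metric_in_frame_chart_indep lp lm A s c c' q :
  glued Phip Phim -> rigging_conditions Phip Phim lp lm ->
  chart_dom s q -> chart_dom c (Phip q) -> chart_dom c' (Phip q) ->
  metric_in_frame Phip (renormalize A lp) s c q =
  metric_in_frame Phip (renormalize A lp) s c' q.
Proof.
move=> [_ _ _ _ hff] [_ _ _ _ hlg] sq cq c'q.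
have mq := chart_atP (Phim q); set cm := chart_at _ in mq.
have pbE : pullback_metric Phip s c q = pullback_metric Phip s c' q.
  by rewrite (hff _ _ _ _ sq cq mq) (hff _ _ _ _ sq c'q mq).
have [llE leE] := hlg _ _ _ _ sq cq mq.
have [llE' leE'] := hlg _ _ _ _ sq c'q mq.
rewrite -llE' in llE; rewrite -leE' in leE.
have elE : tangent Phip s c q *m metric c (Phip q) *m (lp c q)^T =
    tangent Phip s c' q *m metric c' (Phip q) *m (lp c' q)^T.
  apply: trmx_inj; rewrite !trmx_mul !trmxK !tr_metric // !mulmxA.
  exact: leE.
rewrite !metric_in_frameE pbE /renormalize !linearZ /=.
by rewrite -!scalemxAl llE leE elE.
Qed.

Lemma jump_calH_normalE lp lm n s cp cm q : normal_form Phip lp n ->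
  chart_dom s q -> chart_dom cp (Phip q) ->
  jump_calH Phip Phim lp lm n s cp cm q = block_mx 0 0 0
    (cov_deriv Phip lp s cp q *m metric cp (Phip q) *m (tangent Phip s cp q)^T -
     cov_deriv Phim lm s cm q *m metric cm (Phim q) *m (tangent Phim s cm q)^T).
Proof.
move=> hn sq cq; rewrite /jump_calH (covector_in_frame_normal hn sq cq).
by rewrite !calH_normalE opp_block_mx add_block_mx !subr0.
Qed.

(** Since $n_a = n_b = 0$, the three terms of [calG] with such a factor drop out, and $n^i$ becomes
    the [ord0] column of the inverse metric. *)
Lemma calG_tangentialE lp lm n s cp cm q a b : normal_form Phip lp n ->
  chart_dom s q -> chart_dom cp (Phip q) ->
  let G := metric_in_frame Phip lp s cp q in
  let gi := invmx G in
  let N := gi ord0 ord0 in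
  let J := jump_calH Phip Phim lp lm n s cp cm q in
  calG Phip Phim lp lm n s cp cm q (rshift 1 a) (rshift 1 b) =
  - (N * J (rshift 1 a) (rshift 1 b)) - G (rshift 1 a) (rshift 1 b) *
      ((\sum_i \sum_j gi i ord0 * gi j ord0 * J i j) -
        N * \sum_i \sum_j gi i j * J j i).
Proof.
move=> hn sq cq G gi N J.
have ndE i : covector_in_frame Phip lp s cp q n 0 i = (i == ord0)%:R.
  by rewrite (covector_in_frame_normal hn sq cq) mxE.
have nuE i : \sum_j gi i j * covector_in_frame Phip lp s cp q n 0 j = gi i ord0.
  rewrite (bigD1 ord0) //= ndE eqxx mulr1 big1 ?addr0 // => j /negPf j0.
  by rewrite ndE j0 mulr0.
rewrite /calG mxE -/G -/gi -/J !ndE !rshift1_neq_ord0 !mulr0 mul0r add0r subr0.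
rewrite add0r; congr (- (_ * _) - _ * (_ - _ * _)).
- rewrite (bigD1 ord0) //= ndE eqxx mulr1 nuE big1 ?addr0 // => j /negPf j0.
  by rewrite ndE j0 mulr0.
- by apply: eq_bigr => i _; apply: eq_bigr => j _; rewrite !nuE.
- rewrite (bigD1 ord0) //= ndE eqxx mulr1 nuE big1 ?addr0 // => j /negPf j0.
  by rewrite ndE j0 mulr0.
Qed.

End Gluing.

(** * Exclusion of signature change *)

Theorem corollary3 (R : realType) (m : nat)
  (Mp Mm : spacetime R m)
  (Sg : manifold R [set: 'rV[R]_m])
  (Phip : Sg -> Mp) (Phim : Sg -> Mm)
  (hglue : glued Phip Phim)
  (lp : charts Mp -> Sg -> 'rV[R]_m.+1) (lm : charts Mm -> Sg -> 'rV[R]_m.+1)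
  (hrig : rigging_conditions Phip Phim lp lm)
  (A : Sg -> R) (hA : C2_function A) (hA0 : forall q, A q != 0)
  (n : charts Mp -> Sg -> 'rV[R]_m.+1)
  (hn : normal_form Phip (renormalize A lp) n)
  (kappa Lambda : R) (hkappa : 0 < kappa) (hLambda : Lambda != 0)
  (htau : forall (s : charts Sg) (cp : charts Mp) (cm : charts Mm) (q : Sg),
     chart_dom s q -> chart_dom cp (Phip q) -> chart_dom cm (Phim q) ->
     tau_tangential Phip Phim (renormalize A lp) (renormalize A lm)
       kappa n s cp cm q
     = - Lambda *: pullback_metric Phip s cp q) :
  signature_changing_set Phip n = set0.
Proof.
have [hPhip _ hPhim _ _] := hglue.
(* Both parts of $S$ consist of null points in the closure of the non-null set. *)
suff key q : closure [set p | norm_sq Phip n p != 0] q ->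
    norm_sq Phip n q != 0.
  apply/seteqP; split => // q [] [cl /= N0].
    suff : norm_sq Phip n q != 0 by rewrite N0 eqxx.
    by apply: key; apply: closure_subset cl => p /=; exact: lt0r_neq0.
  suff : norm_sq Phip n q != 0 by rewrite N0 eqxx.
  by apply: key; apply: closure_subset cl => p /=; exact: ltr0_neq0.
move=> clq; apply/eqP => N0.
pose s := chart_at q.
pose cp := chart_at (Phip q); pose cm := chart_at (Phim q).
have sq : chart_dom s q by exact: chart_atP.
have cpq : chart_dom cp (Phip q) by exact: chart_atP.
have cmq : chart_dom cm (Phim q) by exact: chart_atP.
pose G p := metric_in_frame Phip (renormalize A lp) s cp p.
pose Cp p := cov_deriv Phip (renormalize A lp) s cp p *m metric cp (Phip p) *m
  (tangent Phip s cp p)^T.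
pose Cm p := cov_deriv Phim (renormalize A lm) s cm p *m metric cm (Phim p) *m
  (tangent Phim s cm p)^T.
pose J p := Cp p - Cm p.
(* [norm_sq] uses a chart chosen separately at each point; the limit at [q] requires the single
   chart [cp]. *)
have norm_sqG p : chart_dom s p -> chart_dom cp (Phip p) ->
    norm_sq Phip n p = invmx (G p) ord0 ord0.
  move=> sp cpp; rewrite (norm_sqE hPhip hn sp) /G.
  by rewrite (metric_in_frame_chart_indep A hglue hrig sp cpp (chart_atP _)).
have jump p : chart_dom s p -> chart_dom cp (Phip p) -> chart_dom cm (Phim p) ->
    norm_sq Phip n p != 0 ->
    exists2 lam : R, lam * (1 - m%:R) = kappa ^+ 2 * Lambda &
      forall a b, norm_sq Phip n p * J p a b
        = lam * G p (rshift 1 a) (rshift 1 b).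
  move=> sp cpp cmp Np0.
  pose K := jump_calH Phip Phim (renormalize A lp) (renormalize A lm) n
    s cp cm p.
  have KE : K = block_mx 0 0 0 (J p) by exact: jump_calH_normalE.
  rewrite (norm_sqG p) // in Np0 *.
  set N := invmx _ _ _ in Np0 *.
  (* The factor of $h_{ab}$ once the tangential brane equation is solved for $N J_{ab}$. *)
  pose lam := kappa ^+ 2 * Lambda -
    (\sum_i \sum_j invmx (G p) i ord0 * invmx (G p) j ord0 * K i j) +
    N * \sum_i \sum_j invmx (G p) i j * K j i.
  have hJ a b : N * J p a b = lam * G p (rshift 1 a) (rshift 1 b).
    have /matrixP/(_ a b) := htau s cp cm p sp cpp cmp.
    rewrite [LHS]mxE /tau [LHS]mxE [RHS]mxE calG_tangentialE //.
    rewrite -/(G p) -/K -/N.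
    have -> : pullback_metric Phip s cp p a b = G p (rshift 1 a) (rshift 1 b).
      by rewrite /G metric_in_frameE block_mxEdr.
    have -> : K (rshift 1 a) (rshift 1 b) = J p a b by rewrite KE block_mxEdr.
    move=> /(congr1 ( *%R (kappa ^+ 2))).
    rewrite mulrA mulfV ?mul1r; last by rewrite expf_neq0 // gt_eqF.
    rewrite /lam; move: (\sum_i _) (N * \sum_i _) => S NT /eqP.
    by rewrite subr_eq => /eqP /(congr1 -%R); rewrite opprK => ->; ring.
  exists lam => //.
  apply: (umbilical_jump_factor (J := K)) => //.
  - exact: metric_in_frame_unit hn _ _.
  - exact: tr_metric_in_frame.
  - move=> i; rewrite -(lshift1_ord0 0) KE.
    by case: (split_ordP i) => ? ->; rewrite ?block_mxEul ?block_mxEdl mxE.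
  - move=> i; rewrite -(lshift1_ord0 0) KE.
    by case: (split_ordP i) => ? ->; rewrite ?block_mxEul ?block_mxEur mxE.
  - by move=> a b; rewrite -hJ KE block_mxEdr.
have near_dom : \forall p \near q,
    [/\ chart_dom s p, chart_dom cp (Phip p) & chart_dom cm (Phim p)].
  apply: filterS3 (chart_dom_near sq) (near_chart_dom_comp hPhip cpq)
    (near_chart_dom_comp hPhim cmq).
  by [].
have uG : G q \in unitmx by exact: metric_in_frame_unit hn _ _.
rewrite norm_sqG // in N0.
have c0 : kappa ^+ 2 * Lambda != 0.
  by rewrite mulf_neq0 // expf_neq0 // gt_eqF.
have [m1|m1|m1] := ltngtP m 1.
(* For $m = 0$ the inverse frame metric has the single entry $(n,n)$, which cannot vanish. *)
- have gi0 : invmx (G q) = 0.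
    apply/matrixP => i j; rewrite mxE -N0.
    have ord00 (k : 'I_(1 + m)) : k = ord0.
      apply: val_inj => /=; apply/eqP; rewrite -leqn0 -ltnS.
      exact: leq_trans (ltn_ord k) m1.
    by rewrite (ord00 i) (ord00 j).
  have := mulVmx uG; rewrite gi0 mul0mx => /matrixP/(_ ord0 ord0).
  by rewrite !mxE eqxx => /eqP; rewrite eq_sym oner_eq0.
- have m1' : (1 : R) - m%:R != 0 by rewrite subr_eq0 eq_sym pnatr_eq1 gtn_eqF.
  pose lam := kappa ^+ 2 * Lambda / (1 - m%:R).
  have [a [b hab]] := unitmx_hyperplane_neq0 m1 uG.
  (* As $m \neq 1$, the factor is the same constant [lam] at all non-null points. So [D] vanishes at
     those near [q], which accumulate at [q], while $D(q) = -\lambda h_{ab} \neq 0$ by the choice of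
     [a] and [b]. *)
  pose D p := invmx (G p) ord0 ord0 * J p a b
    - lam * G p (rshift 1 a) (rshift 1 b).
  have [[hlp hlm] _ _ _ _] := hrig.
  have cG i j : {for q, continuous (fun p => G p i j)}.
    exact: continuous_metric_in_frame.
  have cD : {for q, continuous D}.
    apply: cvgB; last by apply: cvgM; [exact: cvg_cst|exact: cG].
    apply: cvgM; first exact: (continuous_invmx uG).
    suff : {for q, continuous (fun p => J p a b)} by [].
    have -> : (fun p => J p a b) = fun p => Cp p a b - Cm p a b.
      by apply/funext => p; rewrite /J mxE; congr (_ + _); rewrite mxE.
    have cCp : {for q, continuous (fun p => Cp p a b)}.
      exact: continuous_tangential_cov_deriv.
    have cCm : {for q, continuous (fun p => Cm p a b)}.
      exact: continuous_tangential_cov_deriv.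
    exact: cvgB cCp cCm.
  have Dq0 : D q != 0.
    rewrite /D N0 mul0r sub0r oppr_eq0; apply: mulf_neq0 => //.
    by apply: mulf_neq0; rewrite ?invr_eq0.
  have nD : \forall p \near q, D p != 0 by exact: cvgr_neq0 cD Dq0.
  have [p [/= Np0 [[sp cpp cmp] Dp0]]] := clq _ (filterI near_dom nD).
  have [lam' hlam' hJ] := jump p sp cpp cmp Np0.
  have lamE : lam' = lam by rewrite /lam -hlam' mulfK.
  by move: Dp0; rewrite /D -norm_sqG // hJ lamE subrr eqxx.
(* For $m = 1$, any non-null point near [q] gives $0 = \kappa_n^2\Lambda$. *)
- have [p [/= Np0 [sp cpp cmp]]] := clq _ near_dom.
  have [lam + _] := jump p sp cpp cmp Np0.
  by rewrite m1 subrr mulr0 => /esym /eqP; rewrite (negPf c0).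
Qed.
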